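(* Let $K=\mathbb{C}(t)^{\mathrm{alg}}$ be the algebraic closure of the field of rational functions $\mathbb{C}(t)$, equipped with the derivation $\delta=\frac{d}{dt}$ (the unique extension to $K$ of the $\mathbb{C}$-linear derivation $\frac{d}{dt}$ of $\mathbb{C}(t)$). Then there exists a $D$-variety structure $s$ on the projective line $\mathbb{P}^1_K$ over $(K,\delta)$ such that $(\mathbb{P}^1_K,s)$ has no proper $D$-subvarieties over $K$.
   Context: A $D$-variety over a differential field $(K,\delta)$ is an algebraic variety $Y$ over $K$ equipped with a derivation on $\mathcal{O}_Y$ that extends $\delta$ on $K$. Such a derivation corresponds to a regular section $s:Y\to\tau Y$ of the prolongation $\tau Y\to Y$, a torsor of $TY\to Y$ which, in affine coordinates $x=(x_1,\dots,x_n)$, $y=(y_1,\dots,y_n)$, is defined over (the affine chart of) $Y$ by the equations $f^\delta(x)+\sum_{i=1}^n\frac{\partial f}{\partial x_i}(x)y_i=0$ for $f\in K[x]$ ranging over generators of the ideal of $Y$, where $f^\delta$ is obtained from $f$ by applying $\delta$ to its coefficients. Since $\mathbb{P}^1$ is defined over the constants $\mathbb{C}$, $\tau\mathbb{P}^1_K=T\mathbb{P}^1_K$, so a $D$-variety structure on $\mathbb{P}^1_K$ is given by a regular section of $T\mathbb{P}^1_K\to\mathbb{P}^1_K$. A $D$-subvariety of $(Y,s)$ is a closed subvariety $Y'\subseteq Y$ over $K$ (possibly reducible) with $s(Y')\subseteq\tau(Y')$; equivalently, the ideal sheaf of $Y'$ is preserved by the derivation. ''Proper $D$-subvariety'' means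 a nonempty $D$-subvariety different from $Y$. *)

(* Defs.v *)
From HB Require Import structures.
From mathcomp Require Import all_boot all_order all_algebra.
From mathcomp Require Import reals complex mpoly ring.

Set Implicit Arguments.
Unset Strict Implicit.
Unset Printing Implicit Defensive.

Import GRing.Theory.
Local Open Scope ring_scope.

Notation tofrac := FracField.tofrac.

Definition derivation (A : nzRingType) (D : A -> A) : Prop :=
  (forall x y, D (x + y) = D x + D y) /\
  (forall x y, D (x * y) = D x * y + x * D y).

(* d/dt on F(t), by the quotient rule on a representative; ddt_frac below shows
   that the choice of the representative is irrelevant. *)
Definition ddt (F : fieldType) (f : {fraction {poly F}}) : {fraction {poly F}} :=
  let n := \n_(repr f) in let d := \d_(repr f) in
  tofrac (n^`() * d - n * d^`()) / tofrac (d ^+ 2).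

Lemma frac_repr (F : fieldType) (f : {fraction {poly F}}) :
  f = tofrac (\n_(repr f)) / tofrac (\d_(repr f)).
Proof.
rewrite -[LHS]reprK; case: (repr f) => -[a b] /= b0.
unlock FracField.tofrac.
rewrite -[(_)^-1]FracField.pi_inv -[RHS]FracField.pi_mul; congr (\pi_(_))%qT.
rewrite /FracField.mulf /FracField.invf !numden_Ratio ?oner_neq0 //.
by rewrite mulr1 mul1r; apply: val_inj; rewrite /Ratio val_insubd /= b0.
Qed.

Lemma ddt_frac (F : fieldType) (n d : {poly F}) : d != 0 ->
  ddt (tofrac n / tofrac d) = tofrac (n^`() * d - n * d^`()) / tofrac (d ^+ 2).
Proof.
move=> d0; rewrite /ddt; have := frac_repr (tofrac n / tofrac d).
case: (repr _) => -[a b] /= b0 /eqP.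
rewrite eqr_div ?tofrac_eq0 // -!tofracM tofrac_eq => /eqP E.
apply/eqP; rewrite eqr_div ?tofrac_eq0 ?expf_neq0 // -!tofracM tofrac_eq; apply/eqP.
have := congr1 (fun p : {poly F} => p^`()) E; rewrite !derivM => E'.
have -> : (n^`() * d - n * d^`()) * b ^+ 2 =
  (n^`() * b + n * b^`()) * b * d - (n * b) * (b^`() * d + d^`() * b) by ring.
have -> : (a^`() * b - a * b^`()) * d ^+ 2 =
  (a^`() * d + a * d^`()) * b * d - (a * d) * (b^`() * d + d^`() * b) by ring.
by rewrite E' E.
Qed.

(* iota exhibits K as an algebraic closure of F(t). *)
Definition algebraic_closure_of_ratfun (F : fieldType) (K : closedFieldType)
    (iota : {rmorphism {fraction {poly F}} -> K}) : Prop :=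
  forall z : K, algebraicOver iota z.

Section ProjectiveLine.

Variable K : closedFieldType.

(* Homogeneous coordinates; proportional vectors are distinct terms, but closed
   sets, being cut out by homogeneous polynomials, do not separate them. *)
Definition P1 : Type := {v : 'rV[K]_2 | v != 0}.

(* K is algebraically closed, so a closed subvariety over K is the same thing as
   a Zariski closed set of K-points. *)
Definition closedP1 (Y : P1 -> Prop) : Prop :=
  exists S : {mpoly K[2]} -> Prop,
    (forall F, S F -> exists d : nat, F \is d.-homog) /\
    (forall P : P1, Y P <-> forall F, S F -> F.@[(sval P) 0] = 0).

Definition chart_vec (j : 'I_2) (x : K) : 'rV[K]_2 :=
  \row_i (if i == j then 1 else x).

Lemma chart_vec_neq0 j x : chart_vec j x != 0.
Proof.
by apply/eqP => /rowP /(_ j) /eqP; rewrite !mxE eqxx oner_eq0.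
Qed.

(* chart 0 x = [1 : x] and chart 1 y = [y : 1]; they agree when x * y = 1. *)
Definition chart (j : 'I_2) (x : K) : P1 := exist _ (chart_vec j x) (chart_vec_neq0 j x).

(* A regular section of T P^1 = tau P^1, which in chart j is the polynomial map
   x |-> (x, (coord j).[x]) from A^1 to T A^1 = A^1 x A^1. The charts of T P^1 are
   glued along the prolongation of x * y = 1, that is (x, u) in chart 0 and
   (y, v) in chart 1 are the same tangent vector iff x * y = 1 and
   x * v + y * u = 0. *)
Record regular_section : Type := RegularSection {
  coord :> 'I_2 -> {poly K};
  coord_glue : forall x y : K, x * y = 1 ->
    x * (coord 1).[y] + y * (coord 0).[x] = 0 }.

Variable delta : K -> K.

Definition vanishes_on (Z : K -> Prop) (f : {poly K}) : Prop :=
  forall x, Z x -> f.[x] = 0.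

(* (x, y) lies in the prolongation of the closed subset Z of A^1. *)
Definition tau (Z : K -> Prop) (x y : K) : Prop :=
  Z x /\ forall f, vanishes_on Z f ->
    (map_poly delta f).[x] + f^`().[x] * y = 0.

Definition D_subvariety (s : regular_section) (Y : P1 -> Prop) : Prop :=
  closedP1 Y /\
  forall (j : 'I_2) (x : K), Y (chart j x) ->
    tau (fun z => Y (chart j z)) x (s j).[x].

Definition proper_D_subvariety (s : regular_section) (Y : P1 -> Prop) : Prop :=
  [/\ D_subvariety s Y, exists P, Y P & exists P, ~ Y P].

(* The derivation of the coordinate ring of chart j attached to s. *)
Definition chart_derivation (s : regular_section) (j : 'I_2) (f : {poly K}) :
    {poly K} :=
  map_poly delta f + f^`() * s j.

Lemma D_subvariety_ideal (s : regular_section) (Y : P1 -> Prop) :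
  D_subvariety s Y <->
  closedP1 Y /\ forall (j : 'I_2) (f : {poly K}),
    vanishes_on (fun z => Y (chart j z)) f ->
    vanishes_on (fun z => Y (chart j z)) (chart_derivation s j f).
Proof.
split=> -[cY sY]; split=> //.
  by move=> j f f0 x Yx; rewrite hornerD hornerM; apply: (sY j x Yx).2.
by move=> j x Yx; split=> // f f0; rewrite -hornerM -hornerD; apply: sY.
Qed.

End ProjectiveLine.

(* Main.v *)
Require Import Defs.
From mathcomp Require Import all_boot all_order all_algebra.
From mathcomp Require Import reals complex mpoly ring zify boolp.

Import Order.TTheory GRing.Theory Num.Theory.
Local Open Scope ring_scope.

(** The section is [x' = t + x^2], that is [y' = - (1 + t y^2)] at infinity, the
    Riccati equation of Airy's equation. A proper closed subset of the line is
    finite, and each point [x] of a finite D-subvariety is a solution of the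
    equation in [K]; the point at infinity is not one.

    For a solution [x] in [K], choose [P] in [C[t][X]] with [P(x) = 0], of minimal
    degree [n] in [X], with leading coefficient of minimal degree in [t]. The
    derivation [D] with [D t = 1] and [D X = t + X^2] maps [P] to a polynomial of
    degree at most [n + 1] vanishing at [x], so [D P = (n X + b) P] for some [b]
    in [C[t]]. The coefficients [q_k] of [X^(n-k)] satisfy
      [(k+1) q_(k+1) = q_k' - b q_k + (n-k+1) t q_(k-1)],
    and a comparison of leading terms contradicts [q_(n+1) = 0]: if [b] is not
    constant the terms [- b q_k] dominate, and otherwise the leading coefficients
    keep the same sign. *)

(** * The recurrence for the [q k], by leading terms *)

Section SymmetricPowerOfAiry.

Variables (F : numFieldType) (n : nat) (b : {poly F}) (q : nat -> {poly F}).
Hypotheses (n_gt0 : (0 < n)%N) (q0_neq0 : q 0%N != 0).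
Hypothesis q1E : q 1%N = (q 0%N)^`() - b * q 0%N.
Hypothesis qSSE : forall k, (k < n)%N ->
  k.+2%:R *: q k.+2 =
    (q k.+1)^`() - b * q k.+1 + (n - k)%:R *: ('X * q k).

Lemma coef_qSS k i : (k < n)%N -> (q k.+2)`_i =
  k.+2%:R^-1 * ((q k.+1)`_i.+1 *+ i.+1 - (b * q k.+1)`_i
                + (n - k)%:R * ('X * q k)`_i).
Proof.
move=> kn; rewrite -coef_deriv -coefZ -coefB -coefD -qSSE // coefZ.
by rewrite mulKf // pnatr_eq0.
Qed.

(** The degree of [b * q k] exceeds those of the derivative of [q k] and of ['X * q k.-1], so each
    step adds the degree of [b]. *)
Lemma size_airy_cofactor_nonconst : (1 < size b)%N ->
  forall k, (k <= n.+1)%N -> size (q k) = (size (q 0%N) + k * (size b).-1)%N.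
Proof.
move=> b1.
have sD (p : {poly F}) : p != 0 -> (size p^`() < size p)%N by exact: lt_size_deriv.
have sb (p : {poly F}) : p != 0 -> size (b * p) = (size p + (size b).-1)%N.
  move=> p0; have b0 : b != 0 by rewrite -size_poly_gt0; lia.
  have arith u v : (1 < u)%N -> (u + v).-1 = (v + u.-1)%N by lia.
  by rewrite size_mul // arith.
have stp (p : {poly F}) : p != 0 -> size (p^`() - b * p) = (size p + (size b).-1)%N.
  move=> p0; have lt_D : (size p^`() < size (- (b * p)))%N.
    by rewrite size_polyN sb //; have := sD _ p0; lia.
  by rewrite addrC size_polyDl // size_polyN sb.
(* The recurrence looks back two indices, so the induction carries two consecutive sizes. *)
suff H k : ((k <= n.+1)%N -> size (q k) = (size (q 0%N) + k * (size b).-1)%N) /\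
  ((k.+1 <= n.+1)%N -> size (q k.+1) = (size (q 0%N) + k.+1 * (size b).-1)%N).
  by move=> k; case: (H k).
have s0 : (0 < size (q 0%N))%N by rewrite size_poly_gt0.
elim: k => [|k [IH1 IH2]].
  by split=> _; rewrite ?addn0 // q1E stp // mul1n.
split=> // kn.
have qk0 : q k.+1 != 0 by rewrite -size_poly_gt0 IH2; lia.
have : size (k.+2%:R *: q k.+2) = (size (q k.+1) + (size b).-1)%N.
  rewrite qSSE; last lia.
  rewrite size_polyDl stp //.
  apply: leq_ltn_trans (size_scale_leq _ _) _.
  have qkn0 : q k != 0 by rewrite -size_poly_gt0 IH1 ?addn_gt0 ?s0 //; lia.
  rewrite mulrC size_mulX // IH1 ?IH2; [|lia|lia].
  rewrite mulSn; lia.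
rewrite size_scale ?pnatr_eq0 // => ->; rewrite IH2; last lia.
by rewrite [in RHS]mulSnr addnA.
Qed.

Let m := (size (q 0%N)).-1.
Let a := lead_coef (q 0%N).

(* Give the variable of the Airy equation weight 1. Then [q k] has weight at most
   [m + k / 2]; the even terms reach this weight, and so do the odd ones if
   [beta] is nonzero; otherwise these reach the next possible weight. *)
Lemma coef_airy_cofactor_const (beta : F) : b = beta%:P -> forall j,
  ((j.*2 <= n.+1)%N -> (size (q j.*2) <= (m + j).+1)%N /\
     exists2 A, 0 < A & (q j.*2)`_(m + j) = a * A) /\
  ((j.*2.+1 <= n.+1)%N -> [/\ (size (q j.*2.+1) <= (m + j).+1)%N,
     exists2 B, 0 < B & (q j.*2.+1)`_(m + j) = - beta * (a * B) &
     beta = 0 -> exists C, [/\ 0 <= C, (0 < j)%N -> 0 < C &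
       ('X * q j.*2.+1)`_(m + j) = a * C]]).
Proof.
move=> bE.
have s0 : size (q 0%N) = m.+1.
  by rewrite /m prednK // size_poly_gt0.
have vanish (p : {poly F}) i : (size p <= i)%N -> p`_i = 0 by move=> ?; rewrite nth_default.
elim=> [|j [IHe IHo]].
  rewrite addn0 double0; split=> _.
    by split; [rewrite s0 | exists 1; rewrite ?mulr1 // /a lead_coefE].
  have cq i : (q 1%N)`_i = (q 0%N)`_i.+1 *+ i.+1 - beta * (q 0%N)`_i.
    by rewrite q1E bE coefB coef_deriv coefCM.
  split.
  - by apply/leq_sizeP => i mi; rewrite cq !vanish ?mul0rn ?mulr0 ?subr0 ?s0 //; lia.
  - by exists 1; rewrite ?mulr1 // cq vanish ?s0 // mul0rn sub0r mulNr /a lead_coefE.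
  (* Here [q 1] is the derivative of [q 0], hence [C = m]. This is zero for [m = 0], so positivity
     is claimed only for [0 < j]; the factor ['X] makes the index [m - 1] harmless. *)
  - move=> b0; exists m%:R; split=> //.
    rewrite coefXM; case: (posnP m) => [->|m0]; first by rewrite mulr0.
    by rewrite cq b0 mul0r subr0 prednK // mulr_natr /a lead_coefE.
have even_step : (j.*2.+2 <= n.+1)%N -> (size (q j.*2.+2) <= (m + j.+1).+1)%N /\
     exists2 A, 0 < A & (q j.*2.+2)`_(m + j.+1) = a * A.
  move=> kn.
  have [se [A A0 cA]] := IHe ltac:(lia).
  have [so _ _] := IHo ltac:(lia).
  have kn' : (j.*2 < n)%N by lia.
  split.
    apply/leq_sizeP => i mi; rewrite coef_qSS // bE coefCM coefXM.
    by case: i mi => [|i] mi //=; rewrite !vanish ?mul0rn ?mulr0 ?subr0 ?addr0 ?mulr0 //; lia.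
  exists (j.*2.+2%:R^-1 * ((n - j.*2)%:R * A)).
    by rewrite !mulr_gt0 // ?invr_gt0 ?ltr0n //; lia.
  rewrite coef_qSS // bE coefCM coefXM addnS /= cA !vanish; try lia.
  by rewrite mul0rn mulr0 subr0 add0r; ring.
rewrite doubleS; split=> // kn.
have [se [A A0 cA]] := even_step ltac:(lia).
have [so [B B0 cB] oC] := IHo ltac:(lia).
have kn' : (j.*2.+1 < n)%N by lia.
split.
- apply/leq_sizeP => i mi; rewrite coef_qSS // bE coefCM coefXM.
  by case: i mi => [|i] mi //=; rewrite !vanish ?mul0rn ?mulr0 ?subr0 ?addr0 ?mulr0 //; lia.
(* Both [- b * q j.*2.+2] and ['X * q j.*2.+1] contribute positive multiples of [- beta * a]:
   nothing cancels. *)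
- exists (j.*2.+3%:R^-1 * (A + (n - j.*2.+1)%:R * B)).
    by rewrite mulr_gt0 ?invr_gt0 ?ltr0n // addr_gt0 // mulr_gt0 // ltr0n; lia.
  rewrite coef_qSS // bE coefCM coefXM cA addnS /= cB vanish; last lia.
  by rewrite mul0rn; ring.
- move=> b0; have [C [C0 _ cC]] := oC b0.
  (* The derivative of [q j.*2.+2] supplies the term in [A], positive even if [C = 0]. *)
  have Cp : 0 < j.*2.+3%:R^-1 * ((m + j).+1%:R * A + (n - j.*2.+1)%:R * C).
    rewrite mulr_gt0 ?invr_gt0 ?ltr0n // ltr_pwDl //.
      by rewrite mulr_gt0 ?ltr0n.
    by rewrite mulr_ge0.
  exists (j.*2.+3%:R^-1 * ((m + j).+1%:R * A + (n - j.*2.+1)%:R * C)).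
  split=> //; first exact: ltW.
  rewrite coefXM addnS /= coef_qSS // bE coefCM cC b0 -addnS cA addnS -mulr_natr.
  by ring.
Qed.

(** Contradicts the end of the recurrence, where [q n.+1] stands for a coefficient of [X^(-1)]. For
    constant [b], the parity of [n.+1] and the vanishing of [beta] decide which coefficient to
    inspect. *)
Lemma airy_cofactor_neq0 : q n.+1 != 0.
Proof.
have a0 : a != 0 by rewrite lead_coef_eq0.
have [b1|b1] := ltnP 1 (size b).
  rewrite -size_poly_gt0 size_airy_cofactor_nonconst //.
  by rewrite addn_gt0 size_poly_gt0 q0_neq0.
have [beta bE] : exists beta, b = beta%:P.
  by exists b`_0; apply: size1_polyC.
have [He Ho] := coef_airy_cofactor_const _ bE n.+1./2.
have nE := odd_double_half n.+1.
have nz (p : {poly F}) i c : p`_i = a * c -> 0 < c -> p != 0.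
  move=> pE c0; apply: contraTneq c0 => p0; move: pE; rewrite p0 coef0.
  by move=> /esym/eqP; rewrite mulf_eq0 (negbTE a0) => /eqP ->; rewrite ltxx.
case: (odd n.+1) nE => nE.
  have {}nE : (n.+1./2.*2.+1 = n.+1)%N by lia.
  rewrite -nE; have [_ [B B0 cB] HC] := Ho ltac:(lia).
  have [bz|bnz] := eqVneq beta 0.
    (* As [n.+1] is odd and [n] positive, [n.+1./2] is positive, and so is [C]. *)
    have [C [_ C0 cC]] := HC bz.
    have := nz _ _ _ cC (C0 ltac:(lia)).
    by apply: contraNneq => ->; rewrite mulr0.
  apply/eqP => qz; move/eqP: cB; rewrite qz coef0 eq_sym.
  by rewrite !mulf_eq0 oppr_eq0 (negbTE a0) (negbTE bnz) gt_eqF.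
have {}nE : (n.+1./2.*2 = n.+1)%N by lia.
rewrite -nE; have [_ [A A0 cA]] := He ltac:(lia).
exact: nz cA A0.
Qed.

End SymmetricPowerOfAiry.

(** * Derivations of polynomial values; minimal elements *)

Lemma derivation0 (A : nzRingType) (D : A -> A) : derivation D -> D 0 = 0.
Proof. by case=> DD _; apply: (addrI (D 0)); rewrite -DD !addr0. Qed.

Lemma derivation_horner (A : comNzRingType) (D : A -> A) : derivation D ->
  forall (p : {poly A}) x, D p.[x] = (map_poly D p).[x] + p^`().[x] * D x.
Proof.
move=> derD; have D0 := derivation0 _ _ derD; case: derD => DD DM p x.
elim/poly_ind: p => [|p c IH].
  by rewrite map_poly0 deriv0 !horner0 D0 mul0r addr0.
have -> : map_poly D (p * 'X + c%:P) = map_poly D p * 'X + (D c)%:P.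
  apply/polyP => i; rewrite coef_map_id0 // !coefD !coefMX !coefC coef_map_id0 //.
  by rewrite DD; congr (_ + _); case: i.
rewrite derivD derivM derivX derivC !hornerE DD DM IH.
by ring.
Qed.

Lemma exists_minimum (T : Type) (Q : T -> Prop) (mu : T -> nat) :
  (exists x, Q x) -> exists2 x, Q x & forall y, Q y -> (mu x <= mu y)%N.
Proof.
move=> [x0 Qx0].
have exP : exists k, `[< exists2 x, Q x & mu x = k >].
  by exists (mu x0); apply/asboolP; exists x0.
case: (ex_minnP exP) => k /asboolP [x Qx <-] min_x.
by exists x => // y Qy; apply/min_x/asboolP; exists y.
Qed.

(** * Algebraic solutions of the Riccati equation *)

Section NoAlgebraicSolution.

Variables (F : numFieldType) (K : fieldType) (phi : {rmorphism {poly F} -> K}).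
Hypothesis phi_inj : injective phi.
Variables (delta : K -> K) (x : K).
Hypotheses (delta_der : derivation delta)
  (delta_phi : forall p : {poly F}, delta (phi p) = phi p^`()).

Definition annihilates (P : {poly {poly F}}) := (map_poly phi P).[x] = 0.

Definition minimal_annihilator (P : {poly {poly F}}) :=
  [/\ P != 0, annihilates P,
    forall S, annihilates S -> S != 0 -> (size P <= size S)%N &
    forall S, annihilates S -> S != 0 -> size S = size P ->
      (size (lead_coef P) <= size (lead_coef S))%N].

Lemma exists_minimal_annihilator P : P != 0 -> annihilates P ->
  exists P, minimal_annihilator P.
Proof.
move=> P0 Px.
have [|P1 [P1x P10] P1min] := @exists_minimum _
    (fun S => annihilates S /\ S != 0) (fun S => size S).
  by exists P.
have [|P2 [[P2x P20] sP2] P2min] := @exists_minimum _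
    (fun S => (annihilates S /\ S != 0) /\ size S = size P1)
    (fun S => size (lead_coef S)).
  by exists P1.
exists P2; split=> // S Sx S0; first by rewrite sP2; apply: P1min.
by move=> sS; apply: P2min; rewrite -sP2.
Qed.

(* Gauss' lemma for [minimal_annihilator]: the leading coefficients of the
   annihilating polynomials of minimal degree form an ideal. *)
Lemma minimal_annihilator_dvd P S : minimal_annihilator P -> annihilates S ->
  (size S <= size P)%N -> exists u, S = u *: P.
Proof.
move=> [P0 Px Pmin Plead] Sx sSP.
pose n := (size P).-1.
have sP : size P = n.+1 by rewrite prednK // size_poly_gt0.
(* Division of the coefficients of [X^n] leaves a remainder of smaller degree, against the second
   minimality. *)
exists (S`_n %/ lead_coef P); apply/eqP; rewrite -subr_eq0; apply/negP => /negP.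
set S' := S - _ => S'0.
have S'x : annihilates S'.
  rewrite /annihilates /S' rmorphB /= map_polyZ hornerD hornerN hornerZ.
  by rewrite Sx Px mulr0 subr0.
have sS' : (size S' <= size P)%N.
  by rewrite (leq_trans (size_polyD _ _)) // geq_max sSP size_polyN size_scale_leq.
have eS' : size S' = size P by apply/eqP; rewrite eqn_leq sS' Pmin.
have := Plead _ S'x S'0 eS'.
have -> : lead_coef S' = S`_n %% lead_coef P.
  rewrite lead_coefE eS' /S' coefB coefZ -lead_coefE -/n.
  by rewrite {1}(divp_eq S`_n (lead_coef P)) addrC addKr.
by rewrite leqNgt ltn_modp lead_coef_eq0 P0.
Qed.

(* The derivation of [F[t][X]] with [t' = 1] and [X' = t + X^2]. *)
Definition riccati_derivation (P : {poly {poly F}}) : {poly {poly F}} :=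
  map_poly (@deriv F) P + P^`() * (('X)%:P + 'X ^+ 2).

Lemma coef0_riccati_derivation P :
  (riccati_derivation P)`_0 = (P`_0)^`() + 'X * P`_1.
Proof.
rewrite coefD coef_map mulrDr coefD coefMC coef_deriv mulr1n expr2 mulrA coefMX.
by rewrite addr0 mulrC.
Qed.

Lemma coefS_riccati_derivation P i : (riccati_derivation P)`_i.+1 =
  (P`_i.+1)^`() + 'X * (P`_i.+2 *+ i.+2) + P`_i *+ i.
Proof.
rewrite coefD coef_map mulrDr coefD coefMC coef_deriv expr2 mulrA !coefMX /=.
by case: i => [|i] /=; rewrite ?coef_deriv ?mulr0n ?addr0 ?addrA (mulrC _ 'X).
Qed.

Hypothesis delta_x : delta x = phi 'X + x ^+ 2.

(** Evaluation at [x] intertwines this derivation with [delta], since [x] satisfies the equation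
    imposed on [X]. *)
Lemma riccati_derivation_annihilates P :
  annihilates P -> annihilates (riccati_derivation P).
Proof.
rewrite /annihilates /riccati_derivation => Px.
have := derivation_horner _ _ delta_der (map_poly phi P) x.
rewrite Px (derivation0 _ _ delta_der) delta_x => {1}->.
rewrite rmorphD rmorphM rmorphD rmorphXn /= map_polyC map_polyX deriv_map.
rewrite !hornerE; congr (_.[x] + _).
apply/polyP => i; rewrite [LHS]coef_map [RHS]coef_map_id0 ?(derivation0 _ _ delta_der) //.
by rewrite !coef_map delta_phi.
Qed.

Theorem airy_riccati_no_algebraic_solution P : P != 0 -> ~ annihilates P.
Proof.
move=> P0 Px; have {P P0 Px} [P minP] := exists_minimal_annihilator _ P0 Px.
have [P0 Px _ _] := minP.
pose n := (size P).-1.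
have sP : size P = n.+1 by rewrite prednK // size_poly_gt0.
have n0 : (0 < n)%N.
  rewrite lt0n; apply: contraNneq P0 => nz; move: Px; rewrite /annihilates.
  have /size1_polyC -> : (size P <= 1)%N by rewrite sP nz.
  rewrite map_polyC hornerC => /eqP.
  by rewrite -(rmorph0 phi) (inj_eq phi_inj) polyC_eq0.
have big i : (n < i)%N -> P`_i = 0 by move=> ni; rewrite nth_default // sP.
(* The subtraction cancels the coefficient of [X^(n+1)]. *)
pose S := riccati_derivation P - n%:R *: ('X * P).
have Sx : annihilates S.
  rewrite /annihilates /S rmorphB /= map_polyZ rmorphM /= hornerD hornerN hornerZ.
  by rewrite hornerM riccati_derivation_annihilates // Px !mulr0 subr0.
have S0E : S`_0 = (P`_0)^`() + 'X * P`_1.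
  by rewrite coefB coefZ coefXM coef0_riccati_derivation mulr0 subr0.
have SSE i : S`_i.+1 =
    (P`_i.+1)^`() + 'X * (P`_i.+2 *+ i.+2) + P`_i *+ i - P`_i *+ n.
  by rewrite coefB coefZ coefXM coefS_riccati_derivation mulr_natl.
have sS : (size S <= size P)%N.
  apply/leq_sizeP => -[|i]; rewrite sP // ltnS => ni.
  rewrite SSE !(big i.+1) ?(big i.+2); try lia.
  rewrite linear0 mul0rn mulr0 !add0r.
  by have [->|/eqP ne] := eqVneq i n; rewrite ?subrr // big ?mul0rn ?subrr //; lia.
have [b SE] := minimal_annihilator_dvd _ _ minP Sx sS.
(* The test makes [q n.+1] zero; truncated subtraction alone would give the constant coefficient of
   [P]. *)
pose q k := if (k <= n)%N then P`_(n - k) else 0.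
have solve_w (u v w y : {poly F}) i k : (i + k = n)%N ->
    u = v + y + w *+ i - w *+ n -> k%:R *: w = v - u + y.
  by move=> <- ->; rewrite mulrnDr scaler_nat; ring.
have : q n.+1 != 0.
  apply: (airy_cofactor_neq0 _ _ b).
  - exact: n0.
  - by rewrite /q subn0 -lead_coefE lead_coef_eq0.
  - rewrite /q n0 /= subn0; have nE : n = (n - 1).+1 by lia.
    have := SSE (n - 1)%N; rewrite SE coefZ -nE (big n.+1) // mul0rn mulr0.
    by move/(solve_w _ _ _ _ _ 1%N); rewrite scale1r addr0; apply; lia.
  - move=> k kn; rewrite /q kn (ltnW kn).
    have [k2|k2] := leqP k.+2 n.
      have := SSE (n - k.+2)%N; rewrite SE coefZ.
      have -> : ((n - k.+2).+1 = n - k.+1)%N by lia.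
      have -> : ((n - k.+1).+1 = n - k)%N by lia.
      by move/(solve_w _ _ _ _ _ k.+2) => ->; rewrite ?scaler_nat ?mulrnAr //; lia.
    (* Now [k.+1 = n]: the last instance of the recurrence is the constant coefficient of
       [S = b *: P]. *)
    have -> : (n - k.+1 = 0)%N by lia.
    have -> : (n - k = 1)%N by lia.
    have := S0E; rewrite SE coefZ scaler0 => ->.
    by rewrite scale1r; ring.
by rewrite /q ltnn eqxx.
Qed.

End NoAlgebraicSolution.

(** * Points of D-subvarieties of the projective line *)

Section PointsOfP1.

Variable K : closedFieldType.

Lemma meval_scale_dhomog n d (F : {mpoly K[n]}) c (v : 'I_n -> K) :
  F \is d.-homog -> F.@[fun i => c * v i] = c ^+ d * F.@[v].
Proof.
move=> /dhomogP Fd; rewrite !mevalE mulr_sumr big_seq [RHS]big_seq.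
apply: eq_bigr => m /Fd <-; rewrite [X in c ^+ X]mdegE mulrCA -prodrXr -big_split /=.
by congr (_ * _); apply: eq_bigr => i _; rewrite exprMn.
Qed.

(** The dehomogenization of [F] in chart [j]. *)
Definition chart_poly (j : 'I_2) (F : {mpoly K[2]}) : {poly K} :=
  \sum_(m <- msupp F) F@_m *: \prod_i (if i == j then 1 else 'X) ^+ m i.

Lemma horner_chart_poly j F x : (chart_poly j F).[x] = F.@[(chart_vec j x) 0].
Proof.
rewrite mevalE horner_sum; apply: eq_bigr => m _.
rewrite hornerZ horner_prod; congr (_ * _); apply: eq_bigr => i _.
by rewrite horner_exp mxE; case: eqP; rewrite !hornerE.
Qed.

Lemma neq_ord2 (i j k : 'I_2) : j != k -> i != j -> i = k.
Proof.
move=> jk ij; apply: val_inj; move: jk ij; rewrite -!val_eqE /=.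
by move: (ltn_ord i) (ltn_ord j) (ltn_ord k); lia.
Qed.

Lemma P1_chart (v : 'rV[K]_2) : v != 0 ->
  exists j x, exists2 c, c != 0 & v = c *: chart_vec j x.
Proof.
move=> /rV0Pn [j vj]; pose k : 'I_2 := if j == 0 then 1 else 0.
have jk : j != k by rewrite /k; case: (eqVneq j 0) => [->|].
exists j, ((v 0 j)^-1 * v 0 k), (v 0 j) => //.
apply/rowP => i; rewrite !mxE; have [->|ij] := eqVneq i j; first by rewrite mulr1.
by rewrite (neq_ord2 _ _ _ jk ij) mulVKf.
Qed.

Lemma chart_vec_change j k (x : K) : j != k -> x != 0 ->
  chart_vec k x = x *: chart_vec j x^-1.
Proof.
move=> jk x0; apply/rowP => i; rewrite !mxE.
have [->|ij] := eqVneq i j; first by rewrite (negbTE jk) mulr1.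
by rewrite (neq_ord2 _ _ _ jk ij) eqxx divff.
Qed.

Lemma meval_scale_chart_vec d (F : {mpoly K[2]}) c j x : F \is d.-homog ->
  F.@[(c *: chart_vec j x) 0] = c ^+ d * (chart_poly j F).[x].
Proof.
move=> Fd; rewrite horner_chart_poly -(meval_scale_dhomog _ _ _ _ _ Fd).
by apply: meval_eq => i; rewrite mxE.
Qed.

(** On the overlap the two dehomogenizations differ by a power of the coordinate. If one is zero,
    the other times ['X] vanishes on all of [K], which is infinite. *)
Lemma chart_poly_neq0 d (F : {mpoly K[2]}) j k :
  F \is d.-homog -> chart_poly k F != 0 -> chart_poly j F != 0.
Proof.
move=> Fd Fk; apply: contraNneq Fk => Fj.
have [<-|jk] := eqVneq j k; first by rewrite Fj.
have : chart_poly k F * 'X == 0.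
  apply: contraT => /closed_nonrootP [x]; rewrite rootE hornerM hornerX mulf_eq0.
  case/norP=> Fx x0; case/negP: Fx.
  rewrite horner_chart_poly (chart_vec_change _ _ _ jk x0).
  by rewrite (meval_scale_chart_vec _ _ _ _ _ Fd) Fj horner0 mulr0.
by rewrite mulf_eq0 polyX_eq0 orbF.
Qed.

(** Some form vanishing on [Y] is nonzero elsewhere, so [Y] is finite. At a point [x] of [Y],
    compare the [tau] condition with the expansion of [delta f.[x] = 0], where [f] has a simple zero
    at [x]. *)
Lemma proper_D_subvariety_point (delta : K -> K) (s : regular_section K) Y :
  derivation delta -> proper_D_subvariety delta s Y ->
  exists j x, Y (chart j x) /\ delta x = (s j).[x].
Proof.
move=> delta_der [[[S [Shom YS]] Ytau] [[u u0] Yu] [[v v0] nYv]].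
have [F SF Fv] : exists2 F, S F & F.@[v 0] != 0.
  apply: contrapT => noF; apply: nYv; apply/YS => F SF /=.
  by apply/eqP; apply: contrapT => /negP Fv; apply: noF; exists F.
have [d Fd] := Shom F SF.
have [j [x [c c0 uE]]] := P1_chart _ u0.
have Yjx : Y (chart j x).
  apply/YS => G SG /=; have [e Ge] := Shom G SG.
  have := (YS _).1 Yu G SG; rewrite /= uE (meval_scale_chart_vec _ _ _ _ _ Ge).
  move/eqP; rewrite mulf_eq0 expf_eq0 (negbTE c0) andbF /= horner_chart_poly.
  by move/eqP.
exists j, x; split=> //.
have Fj : chart_poly j F != 0.
  have [k [y [a a0 vE]]] := P1_chart _ v0.
  apply: (chart_poly_neq0 _ _ _ k Fd); apply: contraNneq Fv => Fk.
  by rewrite vE (meval_scale_chart_vec _ _ _ _ _ Fd) Fk horner0 mulr0.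
have [l [g gx FE]] := multiplicity_XsubC (chart_poly j F) x.
rewrite Fj /= in gx.
(* A function vanishing on the chart of [Y] with a simple zero at [x]. *)
pose f := g * ('X - x%:P).
have fx : f.[x] = 0 by rewrite hornerM hornerXsubC subrr mulr0.
have f'x : f^`().[x] = g.[x].
  by rewrite derivM derivXsubC mulr1 hornerD hornerM hornerXsubC subrr mulr0 add0r.
have [_ /(_ f)] := Ytau j x Yjx.
have -> : (map_poly delta f).[x] = - (g.[x] * delta x).
  apply/eqP; rewrite -addr_eq0 -f'x -derivation_horner // fx.
  by rewrite (derivation0 _ _ delta_der).
rewrite f'x => E.
have {E} : - (g.[x] * delta x) + g.[x] * (s j).[x] = 0.
  apply: E => z Yz; have := (YS _).1 Yz F SF; rewrite /= -horner_chart_poly FE.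
  rewrite !hornerM horner_exp => /eqP; rewrite mulf_eq0 expf_eq0.
  by case/orP=> [/eqP ->|/andP[_ /eqP ->]]; rewrite ?mul0r ?mulr0.
by move/eqP; rewrite addrC subr_eq0 => /eqP /(mulfI gx) ->.
Qed.

Definition riccati_coord (t : K) (j : 'I_2) : {poly K} :=
  if j == 0 then t%:P + 'X^2 else - (1%:P + t *: 'X^2).

Lemma riccati_coord_glue (t x y : K) : x * y = 1 ->
  x * (riccati_coord t 1).[y] + y * (riccati_coord t 0).[x] = 0.
Proof.
move=> xy; rewrite /riccati_coord /= hornerN !hornerD hornerZ !hornerC !hornerXn.
transitivity ((x - t * y) * (x * y - 1)); first by ring.
by rewrite xy subrr mulr0.
Qed.

Definition riccati_section (t : K) : regular_section K :=
  RegularSection (riccati_coord_glue t).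

(** The origin of chart [1], the point at infinity, would require [0 = -1]; its other points are
    inverted. *)
Lemma riccati_section_point (delta : K -> K) t j x : derivation delta ->
  delta x = (riccati_section t j).[x] -> exists z, delta z = t + z ^+ 2.
Proof.
move=> delta_der; rewrite /= /riccati_coord; case: eqP => _.
  by rewrite hornerD hornerC hornerXn; exists x.
rewrite hornerN hornerD hornerZ hornerC hornerXn => xE.
have [_ delta_mul] := delta_der.
have delta0 := derivation0 _ _ delta_der.
have x0 : x != 0.
  apply/eqP => x0; move: xE; rewrite x0 delta0 expr0n mulr0 addr0 => /eqP.
  by rewrite eq_sym oppr_eq0 oner_eq0.
have delta1 : delta 1 = 0.
  by apply: (addrI (delta 1)); rewrite addr0 -{3}[1]mulr1 delta_mul mulr1 mul1r.
(* Adding [delta x * x^-1] turns the left side into [delta (x * x^-1) = 0]. *)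
exists x^-1; apply: (mulfI x0); apply: (addrI (delta x * x^-1)).
rewrite -delta_mul divff // delta1 xE.
by field.
Qed.

End PointsOfP1.

(** * Clearing denominators, and the conclusion *)

Lemma algebraicOver_fraction (F : fieldType) (K : fieldType)
    (iota : {rmorphism {fraction {poly F}} -> K}) x :
  algebraicOver iota x ->
  exists2 P : {poly {poly F}}, P != 0 & (map_poly (iota \o @tofrac _) P).[x] = 0.
Proof.
move=> [p p0 px].
have [d d0 [P PE]] : exists2 d : {poly F}, d != 0 &
    exists P : {poly {poly F}}, tofrac d *: p = map_poly (@tofrac _) P.
  (* Denominators are cleared one coefficient at a time; [d] accumulates their product. *)
  elim/poly_ind: p {p0 px} => [|p c [d d0 [P PE]]].
    by exists 1; rewrite ?oner_eq0 //; exists 0; rewrite scaler0 rmorph0.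
  have b0 : \d_(repr c) != 0 by case: (repr c).
  exists (d * \d_(repr c)); first by rewrite mulf_neq0.
  exists (\d_(repr c) *: P * 'X + (d * \n_(repr c))%:P).
  rewrite rmorphD [X in _ = X + _]rmorphM /= map_polyX map_polyZ map_polyC /= -PE.
  rewrite -!scalerAl scalerA scalerDr !rmorphM /= (mulrC (tofrac \d_(repr c))); congr (_ + _).
  have divE (w u v : {fraction {poly F}}) : v != 0 -> w = u / v -> u = w * v.
    by move=> v0 ->; rewrite divfK.
  have b0' : tofrac \d_(repr c) != 0 by rewrite tofrac_eq0.
  by rewrite (divE _ _ _ b0' (frac_repr c)) -mul_polyC -!polyCM -mulrA (mulrC c).
exists P.
  apply: contraNneq p0 => P0; move/eqP: PE; rewrite P0 rmorph0 scaler_eq0.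
  by rewrite tofrac_eq0 (negbTE d0).
by rewrite map_poly_comp -PE map_polyZ hornerZ (rootP px) mulr0.
Qed.

Lemma ddt_tofrac (F : fieldType) (p : {poly F}) : ddt (tofrac p) = tofrac p^`().
Proof.
have := @ddt_frac F p 1 (oner_neq0 _).
by rewrite expr1n derivC mulr0 subr0 mulr1 rmorph1 !divr1.
Qed.

Theorem mainTheorem5 (R : realType) (K : closedFieldType)
    (iota : {rmorphism {fraction {poly R[i]}} -> K})
    (K_closure : algebraic_closure_of_ratfun iota)
    (delta : K -> K) (delta_der : derivation delta)
    (delta_ddt : forall f : {fraction {poly R[i]}},
       delta (iota f) = iota (ddt f)) :
  exists s : regular_section K,
    ~ exists Y : P1 K -> Prop, proper_D_subvariety delta s Y.
Proof.
exists (riccati_section K (iota (tofrac 'X))) => -[Y properY].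
have [j [x [_ xE]]] := proper_D_subvariety_point _ _ _ _ delta_der properY.
have [z zE] := riccati_section_point _ _ _ _ _ delta_der xE.
have [P P0 Pz] := algebraicOver_fraction _ _ _ _ (K_closure z).
apply: (airy_riccati_no_algebraic_solution _ _ (iota \o @tofrac _) _ _ _
  delta_der _ zE _ P0 Pz).
- by move=> p q /fmorph_inj /eqP; rewrite tofrac_eq => /eqP.
- by move=> p /=; rewrite delta_ddt ddt_tofrac.
Qed.
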